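(* Let $R$ be a complete discrete valuation ring with normalized valuation $v$, fraction field $K$ and finite residue field $k$ of characteristic $p$. Let $X/K$ be a non-singular irreducible projective variety of dimension $d$ and let $\mathcal{X}/R\subseteq \mathbb{P}^N_R$ be a smooth projective model of $X/K$. Let $\phi_R:\mathcal{X}\to\mathcal{X}$ be an $R$-morphism and let $P_R\in\mathcal{X}(R)$ be a periodic point of primitive period $n$ for $\phi_R$. Let $m$ be the primitive period of the reduction $\overline{P}$ for $\overline{\phi}$, let $\mathcal{V}\subset\mathcal{X}$ be the scheme-theoretic union of $\{P_R,\phi_R(P_R),\ldots,\phi_R^{n-1}(P_R)\}$, let $V$ be the cotangent space of $\mathcal{V}\times_R\operatorname{Spec}k$ at $\overline{P}$, and let $r_V$ be the order of the map induced by $\overline{\phi^m}$ on $V$. If $n=m\,r_V\,p^e$ with $e\ge 0$, then $$e\le\begin{cases}1+\log_2(v(p)) & \text{if } p\ne 2,\\[2pt] 1+\log_{\alpha}\!\left(\dfrac{\sqrt5\,v(2)+\sqrt{5\,v(2)^2+4}}{2}\right) & \text{if } p=2,\end{cases}$$ where $\alpha=\frac{1+\sqrt5}{2}$.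
   Context: $R$ is a discrete valuation ring, complete with respect to a normalized valuation $v$, with maximal ideal $\mathfrak{m}$ and uniformizer $\pi$; $K$ is its fraction field and $k=R/\mathfrak{m}$ is finite of characteristic $p$. (If $K$ has characteristic $p$ then $v(p)=\infty$ and the bound is vacuous.) A smooth projective model of $X/K$ is a smooth projective $R$-scheme $\mathcal{X}$ with generic fiber $X$. $\overline{\phi}$ and $\overline{\phi^m}$ denote the restrictions of $\phi_R$ and $\phi_R^m$ to the special fiber, and $\overline{P}\in\mathcal{X}(k)$ is the restriction of $P_R$ to $\operatorname{Spec} k$. The primitive period of a periodic point is the least positive integer $n$ such that the $n$-th iterate fixes the point. The scheme-theoretic union of finitely many $R$-points is the smallest closed subscheme of $\mathcal{X}$ through which all of them factor. The cotangent space of a $k$-scheme $Z$ at a $k$-point $z$ is $\mathfrak{m}_{Z,z}/\mathfrak{m}_{Z,z}^2$; since $\phi_R$ maps $\mathcal{V}$ to itself and $\overline{\phi^m}$ fixes $\overline{P}$, pullback by $\overline{\phi^m}$ induces a $k$-linear map on $V$, and $r_V$ is its multiplicative order. *)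

(* Defs.v *)
(* MathComp takes the key %R for ring_scope; formulas over the reals of Stdlib
   (the logarithmic bounds) are written with %Re. *)
From Stdlib Require Import Reals.
From HB Require Import structures.
From mathcomp Require Import all_boot all_order all_algebra.
From mathcomp Require Import mpoly.

Set Implicit Arguments.
Unset Strict Implicit.
Unset Printing Implicit Defensive.

Import GRing.Theory.

#[global] Set Warnings "-overwriting-delimiting-key".
Delimit Scope R_scope with Re.

Definition logb (b x : Rdefinitions.R) : Rdefinitions.R := (ln x / ln b)%Re.
Definition golden : Rdefinitions.R := ((1 + sqrt 5) / 2)%Re.

Local Open Scope ring_scope.

Section ValuationRing.
Variables (R : idomainType) (v : R -> nat).

(* [v 0] is a junk value: every clause is restricted to nonzero arguments.
   The last clause says that the elements of nonnegative valuation of the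
   fraction field lie in R. *)
Definition normalized_dvr : Prop :=
  [/\ forall x y, x != 0 -> y != 0 -> v (x * y) = (v x + v y)%N,
      forall x y, x != 0 -> y != 0 -> x + y != 0 ->
        (minn (v x) (v y) <= v (x + y))%N,
      exists2 pi, pi != 0 & v pi = 1%N
    & forall x y, x != 0 -> y != 0 -> (v x <= v y)%N -> exists z, y = z * x].

(* "v x >= M", with the convention v 0 = oo *)
Definition val_ge (M : nat) (x : R) : Prop := x = 0 \/ (M <= v x)%N.

Definition val_complete : Prop :=
  forall u : nat -> R,
    (forall M, exists n0, forall i j, (n0 <= i)%N -> (n0 <= j)%N ->
       val_ge M (u i - u j)) ->
    exists l, forall M, exists n0, forall i, (n0 <= i)%N -> val_ge M (u i - l).

(* [red] is the quotient map from R to its residue field *)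
Definition residue_map (k : nzRingType) (red : R -> k) : Prop :=
  (forall y, exists x, red x = y) /\ (forall x, red x = 0 <-> val_ge 1 x).

End ValuationRing.

(* A closed subscheme of projective N-space over a noetherian ring A is given
   by finitely many homogeneous polynomials [eqs] in n = N + 1 variables. *)
Section Projective.
Variables (A : comNzRingType) (n : nat).
Implicit Types (eqs s : seq {mpoly A[n]}) (f g h : {mpoly A[n]}).

Definition homogeneous_eqs eqs : Prop :=
  forall h, h \in eqs -> exists d, h \is d.-homog.

Definition in_ideal s f : Prop :=
  exists c : nat -> {mpoly A[n]}, f = \sum_(j < size s) c j * s`_j.

(* For homogeneous f, g with deg g > 0: the section of O(deg f) defined by f
   is zero on the open subset D+(g) of the scheme with equations [eqs]. *)
Definition vanishes_on eqs g f : Prop := exists M, in_ideal eqs (g ^+ M * f).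

(* Equations, in affine n-space, of the affine open D+('X_i): the coordinate
   ring A[x]/(eqs, 'X_i - 1) is the degree-zero part of (A[x]/(eqs))['X_i^-1]. *)
Definition chart eqs (i : 'I_n) : seq {mpoly A[n]} := rcons eqs ('X_i - 1).

(* Infinitesimal lifting property of the finitely presented A-algebra
   A[x]/(s) along surjections with kernel of square zero. *)
Definition affine_smooth s : Prop :=
  forall (B C : comNzRingType) (iota : {rmorphism A -> B})
         (q : {rmorphism B -> C}),
    (forall c, exists b, q b = c) ->
    (forall b b', q b = 0 -> q b' = 0 -> b * b' = 0) ->
    forall y : 'I_n -> C,
      (forall h, h \in s -> mmap (q \o iota) y h = 0) ->
      exists2 x : 'I_n -> B, forall i, q (x i) = y i
        & forall h, h \in s -> mmap iota x h = 0.

Definition proj_smooth eqs : Prop := forall i, affine_smooth (chart eqs i).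

(* A morphism phi from the scheme X with equations [eqs] to itself over A is
   given by finitely many n-tuples (F_0 : ... : F_N) of forms of a common
   degree.  The tuple F represents phi on the open subset where its entries
   generate the unit ideal, i.e. on the union of the D+(F_a).  Every morphism is
   of this kind: X is quasi-compact, and the line bundle phi^*O(1) is locally
   trivial. *)
Definition is_morphism eqs (phi : seq (n.-tuple {mpoly A[n]})) : Prop :=
  [/\ forall F, F \in phi -> exists d, forall j, tnth F j \is d.-homog,
      (* the domains of the tuples cover X *)
      exists M, forall i : 'I_n,
        in_ideal (eqs ++ flatten [seq tval F | F <- phi]) ('X_i ^+ M),
      (* two tuples agree on the intersection of their domains *)
      forall F G, F \in phi -> G \in phi -> forall a b l i j : 'I_n,
        vanishes_on eqs ('X_l * tnth F a * tnth G b)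
          (tnth F i * tnth G j - tnth F j * tnth G i)
    & (* the image is contained in X *)
      forall F, F \in phi -> forall h, h \in eqs -> forall a l : 'I_n,
        vanishes_on eqs ('X_l * tnth F a) (h \mPo F)].

End Projective.

(* [eqs] are homogeneous equations over a field; points of the scheme they
   define are the homogeneous primes containing them but not all variables. *)
Section Variety.
Variables (F : fieldType) (n : nat).
Implicit Types (eqs : seq {mpoly F[n]}) (Q : {mpoly F[n]} -> Prop).

Definition scheme_point eqs Q : Prop :=
  [/\ [/\ Q 0, forall f g, Q f -> Q g -> Q (f + g) & forall f g, Q g -> Q (f * g)],
      forall f, Q f -> forall d, Q (\sum_(mu <- msupp f | mdeg mu == d) f@_mu *: 'X_[mu]),
      forall f g, Q (f * g) -> Q f \/ Q g,
      forall h, h \in eqs -> Q h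
    & exists i, ~ Q 'X_i].

(* The underlying space is nonempty, and D+(f), D+(g) meet as soon as both are
   nonempty. *)
Definition irreducible_scheme eqs : Prop :=
  (exists Q, scheme_point eqs Q) /\
  forall df dg f g, f \is df.-homog -> g \is dg.-homog ->
    (forall Q, scheme_point eqs Q -> Q (f * g)) ->
    (forall Q, scheme_point eqs Q -> Q f) \/ (forall Q, scheme_point eqs Q -> Q g).

Definition point_chain eqs (d : nat) : Prop :=
  exists c : nat -> {mpoly F[n]} -> Prop,
    (forall i, (i <= d)%N -> scheme_point eqs (c i)) /\
    (forall i, (i < d)%N -> (forall f, c i f -> c i.+1 f) /\
                            exists2 f, c i.+1 f & ~ c i f).

Definition scheme_dim eqs (d : nat) : Prop :=
  point_chain eqs d /\ ~ point_chain eqs d.+1.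

(* Jacobian criterion at all geometric points, in the charts of affine
   n-space; there the rank has to be n - d. *)
Definition nonsingular eqs (d : nat) : Prop :=
  forall (L : closedFieldType) (iota : {rmorphism F -> L}) (i : 'I_n)
         (y : 'I_n -> L),
    (forall h, h \in chart eqs i -> mmap iota y h = 0) ->
    (\rank (\matrix_(a < size (chart eqs i), j < n)
              mmap iota y (mderiv j (chart eqs i)`_a)) + d = n)%N.

Definition nonsingular_irreducible_variety eqs (d : nat) : Prop :=
  [/\ homogeneous_eqs eqs, irreducible_scheme eqs, scheme_dim eqs d
    & nonsingular eqs d].

End Variety.

(* Over a local ring A, an A-point of projective space is a vector of
   homogeneous coordinates, one of which is a unit, up to a unit of A. *)
Section LocalPoints.
Variables (A : comUnitRingType) (n : nat).
Implicit Types (a b : 'I_n -> A) (phi : seq (n.-tuple {mpoly A[n]})).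

Definition proj_point (eqs : seq {mpoly A[n]}) a : Prop :=
  (exists i, a i \is a GRing.unit) /\ forall h, h \in eqs -> h.@[a] = 0.

Definition same_point a b : Prop :=
  exists2 u, u \is a GRing.unit & forall i, b i = u * a i.

(* The first tuple of phi that represents it near a.  The default value is
   never used when phi is a morphism on a scheme having a as A-point. *)
Definition local_rep phi a : n.-tuple {mpoly A[n]} :=
  nth [tuple 'X_i | i < n] phi
    (find (fun F => [exists j, (tnth F j).@[a] \is a GRing.unit]) phi).

Definition mor_eval phi a : 'I_n -> A := fun j => (tnth (local_rep phi a) j).@[a].

Definition primitive_period phi a (N : nat) : Prop :=
  [/\ (0 < N)%N, same_point (iter N (mor_eval phi) a) a
    & forall i, (0 < i < N)%N -> ~ same_point (iter i (mor_eval phi) a) a].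

(* a tuple of forms representing the m-th iterate of phi near a *)
Fixpoint iter_rep phi (m : nat) a : n.-tuple {mpoly A[n]} :=
  if m is m'.+1 then
    [tuple tnth (local_rep phi (iter m' (mor_eval phi) a)) j \mPo iter_rep phi m' a
      | j < n]
  else [tuple 'X_i | i < n].

(* Forms of degree d in the homogeneous ideal of the scheme-theoretic union of
   the first N points of the orbit of a.  A closed subscheme contains these
   points iff the forms of its ideal vanish at them, so that the ideal of the
   smallest one is spanned by all such forms. *)
Definition orbit_union_form phi a (N d : nat) (f : {mpoly A[n]}) : Prop :=
  f \is d.-homog /\ forall i, (i < N)%N -> f.@[iter i (mor_eval phi) a] = 0.

End LocalPoints.

Definition map_mor (A B : nzRingType) (n : nat) (red : A -> B)
    (phi : seq (n.-tuple {mpoly A[n]})) : seq (n.-tuple {mpoly B[n]}) :=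
  [seq [tuple map_mpoly red (tnth F j) | j < n] | F <- phi].

(* [J d] is the set of forms of degree d of the homogeneous ideal of a closed
   subscheme Z of projective space over k, and z is a k-point of Z.  The local
   ring of projective space at z is a subring of the field k(x_0, ..., x_N);
   with m_z its maximal ideal and J_z the stalk of the ideal of Z, the maximal
   ideal of the local ring of Z is m_z / J_z, and the cotangent space of Z at z
   is m_z / (m_z^2 + J_z). *)
Section Cotangent.
Variables (k : fieldType) (n : nat) (J : nat -> {mpoly k[n]} -> Prop).
Variable z : 'I_n -> k.
Local Notation tofrac := (@FracField.tofrac {mpoly k[n]}).
Implicit Types u w : {fraction {mpoly k[n]}}.

(* (f, g) represents an element f/g of m_z *)
Definition max_rep (d : nat) (f g : {mpoly k[n]}) : Prop :=
  [/\ f \is d.-homog, g \is d.-homog, g.@[z] != 0 & f.@[z] = 0].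

Definition max_ideal u : Prop :=
  exists d f g, max_rep d f g /\ u = tofrac f / tofrac g.

Definition max_ideal_sq u : Prop :=
  exists2 s : seq ({fraction {mpoly k[n]}} * {fraction {mpoly k[n]}}),
    forall ab, ab \in s -> max_ideal ab.1 /\ max_ideal ab.2
    & u = \sum_(ab <- s) ab.1 * ab.2.

Definition ideal_stalk u : Prop :=
  exists d f g, [/\ J d f, g \is d.-homog, g.@[z] != 0 & u = tofrac f / tofrac g].

(* equality in the cotangent space of the classes of u, w in m_z *)
Definition cotangent_eq u w : Prop :=
  exists2 t, max_ideal_sq t & ideal_stalk (u - w - t).

(* Let the tuple of forms G represent near z a self-map of Z fixing z.  Its
   pullback sends the class of f/g to that of f(G)/g(G); the r-th power of the
   induced map on the cotangent space is the identity. *)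
Definition cotangent_power_id (G : n.-tuple {mpoly k[n]}) (r : nat) : Prop :=
  forall d f g, max_rep d f g ->
    cotangent_eq
      (tofrac (iter r (comp_mpoly G) f) / tofrac (iter r (comp_mpoly G) g))
      (tofrac f / tofrac g).

Definition cotangent_order (G : n.-tuple {mpoly k[n]}) (r : nat) : Prop :=
  [/\ (0 < r)%N, cotangent_power_id G r
    & forall i, (0 < i < r)%N -> ~ cotangent_power_id G i].

End Cotangent.

(* forms of degree d of the ideal of the base change along the surjection red *)
Definition base_change_form (A B : nzRingType) (n : nat) (red : A -> B)
    (J : nat -> {mpoly A[n]} -> Prop) (d : nat) (f : {mpoly B[n]}) : Prop :=
  exists2 f0, J d f0 & f = map_mpoly red f0.

(* Main.v *)
(* Let Q_i be the i-th iterate of P under phi^m, and let O be the ring of the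
   functions on the points Q_i coming from the local ring of projective space
   at the common reduction of these points, with q the ideal of the functions
   that vanish at Q_0.  For a step a = rV p^s put D h (i) = h (i + a) - h (i)
   and consider integers c, dl >= 1 such that, for all h in O,
     D h (0) is divisible by pi^dl, and D h lies in R + pi^c O + q^2.
   For s = 0, c = dl = 1 works, since phi^(m rV) is the identity on the
   cotangent space V.  Then D^j h lies in R + pi^min(j c, dl) O + q^2, hence
   D^(j+1) h (0) is divisible by pi^(dl + min(j c, dl)), and expanding
   (1 + D)^p - 1 gives, for the step p a, the pair
     c' = min(v(p) + 1, p c, dl),  dl' = dl + min(v(p), (p - 1) c, dl).
   So c and dl grow like 2^s if p is odd, and like Fibonacci numbers if p = 2.
   For s = e - 1, (1 + D)^p - 1 is zero at Q_0 but D is not; choosing h with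
   D h (0) of minimal valuation dl, the term p D h (0) can only be cancelled by
   D^p h (0), so that min((p - 1) c, dl) <= v(p). *)

Require Import Defs.
From Stdlib Require Import Reals Lra Classical FunctionalExtensionality.
From HB Require Import structures.
From mathcomp Require Import all_boot all_order all_algebra.
From mathcomp Require Import mpoly.
From mathcomp Require Import ring zify.

Set Implicit Arguments.
Unset Strict Implicit.
Unset Printing Implicit Defensive.

Import GRing.Theory.
Local Open Scope ring_scope.

(** * Growth of the distances between the points of an orbit *)

Section OrbitFunctions.
Variables (R : idomainType) (pi : R).
Implicit Types (x y z : nat -> R) (O : (nat -> R) -> Prop).

Definition pi_dvd (M : nat) (c : R) : Prop := exists t, c = pi ^+ M * t.

Lemma pi_dvd0 M : pi_dvd M 0.
Proof. by exists 0; rewrite mulr0. Qed.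

Lemma pi_dvdD M c c' : pi_dvd M c -> pi_dvd M c' -> pi_dvd M (c + c').
Proof. by move=> [y ->] [y' ->]; exists (y + y'); rewrite mulrDr. Qed.

Lemma pi_dvdN M c : pi_dvd M c -> pi_dvd M (- c).
Proof. by move=> [y ->]; exists (- y); rewrite mulrN. Qed.

Lemma pi_dvd_sum M (I : Type) (s : seq I) (P : pred I) (F : I -> R) :
  (forall i, P i -> pi_dvd M (F i)) -> pi_dvd M (\sum_(i <- s | P i) F i).
Proof.
move=> h; elim/big_rec: _ => [|i c Pi]; first exact: pi_dvd0.
by apply: pi_dvdD; apply: h.
Qed.

Lemma pi_dvdW M M' c : (M' <= M)%N -> pi_dvd M c -> pi_dvd M' c.
Proof.
move=> le [y ->]; exists (pi ^+ (M - M') * y).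
by rewrite mulrA -exprD subnKC.
Qed.

Lemma pi_dvdM M M' c c' : pi_dvd M c -> pi_dvd M' c' -> pi_dvd (M + M') (c * c').
Proof. by move=> [y ->] [y' ->]; exists (y * y'); rewrite exprD; ring. Qed.

Lemma pi_dvdMr M c c' : pi_dvd M c -> pi_dvd M (c * c').
Proof. by move=> [y ->]; exists (y * c'); rewrite mulrA. Qed.

(** Sequences stand for functions on the points Q_i, and the shift is pullback by phi^m. Closure
    under pointwise equality stands in for extensionality. *)
Definition shift_ring O : Prop :=
  [/\ forall x y, x =1 y -> O x -> O y,
      forall c, O (fun=> c),
      forall x y, O x -> O y -> O (fun i => x i + y i),
      forall x y, O x -> O y -> O (fun i => x i * y i)
    & forall x, O x -> O (fun i => x i.+1)].

Definition diff (a : nat) x : nat -> R := fun i => x (i + a)%N - x i.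

(* R + pi^c O + q^2, with q the ideal of the functions in O vanishing at 0: the
   functions whose linear part at 0 is divisible by pi^c. *)
Inductive lin O (c : nat) : (nat -> R) -> Prop :=
| lin_const r y : (forall i, y i = r) -> lin O c y
| lin_pi u y : O u -> (forall i, y i = pi ^+ c * u i) -> lin O c y
| lin_mul a b y : O a -> O b -> a 0%N = 0 -> b 0%N = 0 ->
    (forall i, y i = a i * b i) -> lin O c y
| lin_add x z y : lin O c x -> lin O c z -> (forall i, y i = x i + z i) ->
    lin O c y.

(** [dl] measures how close the points of index 0 and [a] are, [c] how close the pullback by [a]
    steps is to the identity on linear parts at 0. *)
Definition near_id O (a c dl : nat) : Prop :=
  (forall x, O x -> pi_dvd dl (diff a x 0%N)) /\
  (forall x, O x -> lin O c (diff a x)).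

Variable O : (nat -> R) -> Prop.
Hypothesis hO : shift_ring O.

Let Oext x y : x =1 y -> O x -> O y. Proof. by case: hO => h _ _ _ _; apply: h. Qed.
Let Ocst c : O (fun=> c). Proof. by case: hO. Qed.
Let OD x y : O x -> O y -> O (fun i => x i + y i).
Proof. by case: hO => _ _ h *; apply: h. Qed.
Let OM x y : O x -> O y -> O (fun i => x i * y i).
Proof. by case: hO => _ _ _ h *; apply: h. Qed.

Lemma shift_ringB x y : O x -> O y -> O (fun i => x i - y i).
Proof.
move=> Ox Oy; apply: Oext (OD Ox (OM (Ocst (-1)) Oy)) => i /=.
by rewrite mulN1r.
Qed.

Lemma shift_ring_shift a x : O x -> O (fun i => x (i + a)%N).
Proof.
move=> Ox; elim: a => [|a IH]; first by apply: Oext Ox => i; rewrite addn0.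
case: hO => _ _ _ _ /(_ _ IH); apply: Oext => i /=.
by rewrite addSnnS.
Qed.

Lemma shift_ring_diff a x : O x -> O (diff a x).
Proof. by move=> Ox; apply: shift_ringB => //; apply: shift_ring_shift. Qed.

Lemma lin_ext c x y : x =1 y -> lin O c x -> lin O c y.
Proof.
move=> e h; apply: (lin_add h (lin_const O c (y := fun=> 0) (fun=> erefl))) => i.
by rewrite e addr0.
Qed.

Lemma linW c c' y : (c' <= c)%N -> lin O c y -> lin O c' y.
Proof.
move=> le; elim=> {y} [r y e|u y Ou e|a b y Oa Ob a0 b0 e|x z y _ Lx _ Lz e].
- exact: lin_const e.
- apply: (lin_pi (OM (Ocst (pi ^+ (c - c'))) Ou)) => i.
  by rewrite e mulrA -exprD subnKC.
- exact: lin_mul e.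
- exact: lin_add e.
Qed.

(** Constants and q^2 absorb any factor, so only the term [pi ^+ c * u] has to gain the power
    [g]. *)
Lemma lin_pi_dvd c g q y : pi_dvd g q -> lin O c y ->
  lin O (g + c) (fun i => q * y i).
Proof.
move=> [w ->]; elim=> {y} [r y e|u y Ou e|a b y Oa Ob a0 b0 e|x z y _ Lx _ Lz e].
- by apply: (lin_const _ _ (r := pi ^+ g * w * r)) => i; rewrite e.
- apply: (lin_pi (OM (Ocst w) Ou)) => i.
  by rewrite e exprD; ring.
- apply: (lin_mul _ (OM (Ocst (pi ^+ g * w)) Oa) Ob) => // [|i].
    by rewrite a0 mulr0.
  by rewrite e; ring.
- by apply: (lin_add Lx Lz) => i; rewrite e mulrDr.
Qed.

Lemma lin_sum c (I : Type) (s : seq I) (P : pred I) (F : I -> nat -> R) :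
  (forall i, P i -> lin O c (F i)) ->
  lin O c (fun n => \sum_(i <- s | P i) F i n).
Proof.
move=> h; elim: s => [|i s IH].
  by apply: (lin_const _ _ (r := 0)) => n; rewrite big_nil.
case Pi: (P i); last by apply: lin_ext IH => n; rewrite big_cons Pi.
by apply: (lin_add (h i Pi) IH) => n; rewrite big_cons Pi.
Qed.

(* Split [a = a 0 + (a - a 0)] and [b = b 0 + (b - b 0)]. *)
Lemma lin_mul_dvd c a b : O a -> O b -> pi_dvd c (a 0%N) -> pi_dvd c (b 0%N) ->
  lin O c (fun i => a i * b i).
Proof.
move=> Oa Ob [u ea] [w eb].
have Oa' := shift_ringB Oa (Ocst (a 0%N)).
have Ob' := shift_ringB Ob (Ocst (b 0%N)).
have L1 := lin_mul c (y := fun i => (a i - a 0%N) * (b i - b 0%N)) Oa' Ob'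
             (subrr _) (subrr _) (fun=> erefl).
have L2 := lin_pi (c := c) (y := fun i => pi ^+ c * (u * b i + w * (a i - a 0%N)))
  (OD (OM (Ocst u) Ob) (OM (Ocst w) Oa')) (fun=> erefl).
apply: (lin_add L1 L2) => i.
by rewrite ea eb; ring.
Qed.

Section NearId.
Variables a c dl : nat.
Hypothesis hnear : near_id O a c dl.

(** D kills constants, and on [pi ^+ g * u] it contributes [g + dl]. For a product of functions
    vanishing at 0, the difference at 0 is the product of their values at [a], each divisible by
    [pi ^+ dl]. *)
Lemma lin_diff_at0 g y : lin O g y -> pi_dvd (dl + minn g dl) (diff a y 0%N).
Proof.
case: hnear => h1 _.
elim=> {y} [r y e|u y Ou e|b b' y Ob Ob' b0 b0' e|x z y _ Lx _ Lz e].
- by rewrite /diff !e subrr; apply: pi_dvd0.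
- rewrite /diff !e -mulrBr addnC; apply: pi_dvdM; last exact: h1.
  by apply: pi_dvdW (geq_minl _ _) _; exists 1; rewrite mulr1.
- apply: (@pi_dvdW (dl + dl)); first by rewrite leq_add2l geq_minr.
  rewrite /diff !e b0 mul0r subr0.
  apply: pi_dvdM; [move: (h1 _ Ob)|move: (h1 _ Ob')];
    by rewrite /diff ?b0 ?b0' subr0.
- have -> : diff a y 0%N = diff a x 0%N + diff a z 0%N by rewrite /diff !e; ring.
  exact: pi_dvdD.
Qed.

(** The term [pi ^+ g * u] gains the factor [pi ^+ c]. The difference of a product [b * b'] is the
    shifted product, whose factors at 0 are divisible by [pi ^+ dl], minus an element of q^2; hence
    the cap [dl]. *)
Lemma lin_diff g y : lin O g y -> lin O (minn (g + c) dl) (diff a y).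
Proof.
case: hnear => h1 h2.
elim=> {y} [r y e|u y Ou e|b b' y Ob Ob' b0 b0' e|x z y _ Lx _ Lz e].
- by apply: (lin_const _ _ (r := 0)) => i; rewrite /diff !e subrr.
- have L : lin O (g + c) (fun i => pi ^+ g * diff a u i).
    by apply: lin_pi_dvd (h2 _ Ou); exists 1; rewrite mulr1.
  apply: lin_ext (linW (geq_minl _ _) L) => i.
  by rewrite /diff !e; ring.
- have L : lin O dl (fun i => b (i + a)%N * b' (i + a)%N).
    apply: (lin_mul_dvd (a := fun i => b (i + a)%N) (b := fun i => b' (i + a)%N)).
    + exact: shift_ring_shift.
    + exact: shift_ring_shift.
    + by move: (h1 _ Ob); rewrite /diff b0 subr0.
    + by move: (h1 _ Ob'); rewrite /diff b0' subr0.
  apply: linW (geq_minr _ _) _.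
  have L' : lin O dl (fun i => - b i * b' i).
    apply: (lin_mul _ (a := fun i => - b i) (b := b')) => //.
      by apply: Oext (shift_ringB (Ocst 0) Ob) => i; rewrite sub0r.
    by rewrite b0 oppr0.
  by apply: (lin_add L L') => i; rewrite /diff !e mulNr.
- by apply: (lin_add Lx Lz) => i; rewrite /diff !e; ring.
Qed.

Lemma iter_diff_lin j x : O x -> lin O (minn (j.+1 * c) dl) (iter j.+1 (diff a) x).
Proof.
move=> Ox; elim: j => [|j IH].
  by rewrite mul1n; apply: linW (geq_minl _ _) _; apply: (proj2 hnear).
rewrite iterS; apply: linW _ (lin_diff IH); lia.
Qed.

Lemma iter_diff_at0 j x : O x ->
  pi_dvd (dl + minn (j * c) dl) (iter j.+1 (diff a) x 0%N).
Proof.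
move=> Ox; case: j => [|j].
  by rewrite mul0n min0n addn0; apply: (proj1 hnear).
rewrite iterS; apply: pi_dvdW _ (lin_diff_at0 (iter_diff_lin j Ox)); lia.
Qed.

End NearId.

(** The shift by [a] is 1 + D, so this is the binomial expansion of (1 + D)^q; the induction is
    Pascal's rule. *)
Lemma shift_binomial a q x i :
  x (i + q * a)%N = \sum_(j < q.+1) 'C(q, j)%:R * iter j (diff a) x i.
Proof.
elim: q i => [|q IH] i.
  by rewrite mul0n addn0 big_ord_recl big_ord0 bin0 mul1r addr0.
rewrite mulSn addnA IH.
have E j : iter j (diff a) x (i + a)%N = iter j (diff a) x i + iter j.+1 (diff a) x i.
  by rewrite iterS /diff; ring.
under eq_bigr do rewrite E mulrDr.
rewrite big_split /= [in RHS]big_ord_recl bin0 [X in X + _]big_ord_recl bin0.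
under [in RHS]eq_bigr do rewrite lift0 binS natrD mulrDl.
rewrite [in RHS]big_split /= -!addrA; congr (_ + _).
congr (_ + _); rewrite [RHS]big_ord_recr /= bin_small // mul0r addr0.
exact: eq_bigr.
Qed.

Lemma diff_mul_prime a p x i : prime p ->
  diff (p * a) x i =
  \sum_(j < p.-1) 'C(p, j.+1)%:R * iter j.+1 (diff a) x i + iter p (diff a) x i.
Proof.
move=> /prime_gt0; case: p => // p _.
rewrite [LHS]/diff shift_binomial big_ord_recl big_ord_recr /= bin0 binn !mul1r.
by rewrite [LHS]addrC addKr.
Qed.

Lemma pi_dvd_bin p w j : prime p -> pi_dvd w p%:R -> (j < p.-1)%N ->
  pi_dvd w 'C(p, j.+1)%:R.
Proof.
move=> pp pw lt; have /dvdnP [q ->] : (p %| 'C(p, j.+1))%N.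
  by apply: prime_dvd_bin => //; lia.
by rewrite natrM mulrC; apply: pi_dvdMr.
Qed.

Lemma near_id_mul p w a c dl : prime p -> pi_dvd w p%:R -> (0 < c)%N -> (0 < dl)%N ->
  near_id O a c dl ->
  near_id O (p * a) (minn w.+1 (minn (p * c) dl))
                    (dl + minn w (minn (p.-1 * c) dl)).
Proof.
move=> pp pw c0 d0 hn; have p1 := prime_gt1 pp.
have bw j := @pi_dvd_bin p w j pp pw.
have ep : p = p.-1.+1 by lia.
split=> x Ox.
- rewrite diff_mul_prime //; apply: pi_dvdD.
    apply: pi_dvd_sum => j _; apply: (@pi_dvdW (w + (dl + minn (j * c) dl))); first lia.
    by apply: pi_dvdM; [apply: bw|apply: iter_diff_at0].
  rewrite {2}ep; apply: pi_dvdW _ (iter_diff_at0 hn p.-1 Ox); lia.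
- have L1 : lin O (minn w.+1 (minn (p * c) dl))
      (fun i => \sum_(j < p.-1) 'C(p, j.+1)%:R * iter j.+1 (diff a) x i).
    apply: (@lin_sum _ 'I_p.-1 _ xpredT
      (fun j i => 'C(p, j.+1)%:R * iter j.+1 (diff a) x i)) => j _.
    (* As [c] and [dl] are positive, a term with a binomial coefficient gains at least one power
       beyond [w]: this is the cap [w.+1]. *)
    apply: (@linW (w + minn (j.+1 * c) dl)); first by nia.
    by apply: lin_pi_dvd; [apply: bw|apply: iter_diff_lin].
  have L2 : lin O (minn w.+1 (minn (p * c) dl)) (iter p (diff a) x).
    rewrite {2}ep; apply: linW _ (iter_diff_lin hn p.-1 Ox); lia.
  by apply: (lin_add L1 L2) => i; rewrite diff_mul_prime.
Qed.

(* The term [p D x] of [(1 + D)^p - 1] cannot be cancelled by those with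
   [2 <= j < p], which are divisible by a higher power of pi. *)
Lemma near_id_last p w a c dl : prime p -> pi_dvd w p%:R -> (0 < c)%N -> (0 < dl)%N ->
  near_id O a c dl -> forall x, O x -> diff (p * a) x 0%N = 0 ->
  pi_dvd (minn (w.+1 + dl) (dl + minn (p.-1 * c) dl)) (p%:R * diff a x 0%N).
Proof.
move=> pp pw c0 d0 hn x Ox; have p1 := prime_gt1 pp.
have bw j := @pi_dvd_bin p w j pp pw.
have ep : p = p.-1.+1 by lia.
have ep2 : p.-1 = p.-2.+1 by lia.
(* Split off the first summand, with coefficient ['C(p, 1)]; since the total vanishes, it is minus
   the sum of the others. *)
rewrite diff_mul_prime // ep2 big_ord_recl /= -ep2 bin1 -addrA.
move/eqP; rewrite addr_eq0 => /eqP ->.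
apply/pi_dvdN/pi_dvdD.
  apply: pi_dvd_sum => j _; rewrite -!iterS.
  apply: (@pi_dvdW (w + (dl + minn (j.+1 * c) dl))); first by nia.
  apply: pi_dvdM; first by apply: bw; rewrite /bump; have := ltn_ord j; lia.
  exact: iter_diff_at0.
rewrite {2}ep; apply: pi_dvdW _ (iter_diff_at0 hn p.-1 Ox); lia.
Qed.

End OrbitFunctions.

(** * Valuations as divisibility by powers of pi, and iteration of the growth step *)

Section Valuation.
Variables (R : idomainType) (v : R -> nat) (pi : R).
Hypotheses (hdvr : normalized_dvr v) (pi0 : pi != 0) (vpi : v pi = 1%N).

Lemma dvr_valM x y : x != 0 -> y != 0 -> v (x * y) = (v x + v y)%N.
Proof. by case: hdvr => h _ _ _; apply: h. Qed.

Lemma dvr_val1 : v 1 = 0%N.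
Proof.
have /eqP := dvr_valM (oner_neq0 R) (oner_neq0 R).
by rewrite mulr1 -{1}[v 1]addn0 eqn_add2l => /eqP.
Qed.

Lemma dvr_val_piX M : v (pi ^+ M) = M.
Proof.
elim: M => [|M IH]; first exact: dvr_val1.
by rewrite exprS dvr_valM ?expf_neq0 // vpi IH.
Qed.

(** Divisibility by powers of [pi] treats 0 uniformly, whereas [v 0] is a junk value. *)
Lemma val_geP M x : val_ge v M x <-> pi_dvd pi M x.
Proof.
split=> [[->|le]|[y ->]]; first exact: pi_dvd0.
- have [->|x0] := eqVneq x 0; first exact: pi_dvd0.
  case: hdvr => _ _ _ /(_ (pi ^+ M) x); rewrite dvr_val_piX expf_neq0 //.
  by move=> /(_ isT x0 le) [z ->]; exists z; rewrite mulrC.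
- have [->|y0] := eqVneq y 0; first by left; rewrite mulr0.
  by right; rewrite dvr_valM ?expf_neq0 // dvr_val_piX leq_addr.
Qed.

Lemma pi_dvd_val M x : x != 0 -> pi_dvd pi M x -> (M <= v x)%N.
Proof. by move=> /eqP x0 /val_geP []. Qed.

Lemma val_pi_dvd M x : (M <= v x)%N -> pi_dvd pi M x.
Proof. by move=> le; apply/val_geP; right. Qed.

Lemma val0_unit x : x != 0 -> v x = 0%N -> x \is a GRing.unit.
Proof.
move=> x0 vx; case: hdvr => _ _ _ /(_ x 1 x0 (oner_neq0 R)).
rewrite vx => /(_ isT) [z e]; apply/unitrP; exists z.
by rewrite -e mulrC -e.
Qed.

Section Residue.
Variables (k : fieldType) (red : {rmorphism R -> k}).
Hypothesis hred : residue_map v red.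

Lemma red_eq0 x : red x = 0 <-> pi_dvd pi 1 x.
Proof. by case: hred => _ /(_ x) ->; apply: val_geP. Qed.

Lemma unit_red x : (x \is a GRing.unit) = (red x != 0).
Proof.
apply/idP/idP => [ux|]; first by rewrite -unitfE rmorph_unit.
move=> /eqP rx; have x0 : x != 0 by apply: contra_not_neq rx => ->; rewrite rmorph0.
apply: val0_unit => //; case E: (v x) => [//|w].
by case: rx; apply/red_eq0/val_pi_dvd; rewrite E.
Qed.

End Residue.

Fixpoint fib (n : nat) : nat :=
  if n is n'.+1 then (if n' is n''.+1 then fib n' + fib n'' else 1)%N else 0%N.

Lemma fibSS n : fib n.+2 = (fib n.+1 + fib n)%N.
Proof. by []. Qed.

Lemma leq_fib n : (fib n <= fib n.+1)%N.
Proof. by case: n => // n; rewrite fibSS leq_addr. Qed.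

Variables (O : (nat -> R) -> Prop) (p a : nat).
Hypotheses (hO : shift_ring O) (pp : prime p) (p0 : p%:R != 0 :> R).
Hypothesis hnear : near_id pi O a 1 1.

Local Notation w := (v p%:R).

(** Growth only matters until it passes [w], hence the minimum with [w.+1]. For odd p, (p - 1) c >=
    2 c, so [2 * c] and [dl] keep the lower bound 2^s. For p = 2 the recursion c' = min(2 c, dl),
    dl' = dl + min(c, dl), up to the cap, yields consecutive Fibonacci numbers. *)
Lemma near_id_exp s : exists c dl,
  [/\ near_id pi O (p ^ s * a) c dl, (0 < c)%N, (0 < dl)%N
    & if p == 2 then (minn w.+1 (fib s.+1) <= c /\ minn w.+1 (fib s.+2) <= dl)%N
      else (minn w.+1 (2 ^ s) <= 2 * c /\ minn w.+1 (2 ^ s) <= dl)%N].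
Proof.
have pw : pi_dvd pi w p%:R by apply: val_pi_dvd.
have p1 := prime_gt1 pp.
elim: s => [|s [c [dl [hn c0 d0 hc]]]].
  by exists 1%N, 1%N; rewrite expn0 mul1n; split=> //; case: ifP => _ /=; lia.
exists (minn w.+1 (minn (p * c) dl)), (dl + minn w (minn (p.-1 * c) dl))%N.
split.
- by rewrite expnS -mulnA; apply: near_id_mul.
- by nia.
- by lia.
- case: (p =P 2%N) hc => [->|/eqP p2] [h1 h2].
    have := leq_fib s; rewrite fibSS in h2; rewrite !fibSS mul1n.
    by lia.
  have p3 : (2 < p)%N by lia.
  have h3 : (2 * c <= p.-1 * c)%N by rewrite leq_mul2r; lia.
  have h4 : (2 * c <= p * c)%N by rewrite leq_mul2r; lia.
  rewrite expnS; move: h1 h2 h3 h4; move: (2 ^ s)%N (p.-1 * c)%N (p * c)%N => A B C.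
  by lia.
Qed.

Lemma orbit_length_bound e x : O x -> x (p ^ e * a)%N != x 0%N ->
  (forall y, O y -> y (p ^ e.+1 * a)%N = y 0%N) ->
  if p == 2 then (fib e.+1 <= w)%N else (2 ^ e <= w)%N.
Proof.
move=> Ox nx per; have pw : pi_dvd pi w p%:R by apply: val_pi_dvd.
have [c [dl [hn c0 d0 hc]]] := near_id_exp e.
set b := (p ^ e * a)%N in nx hn.
(* Starting from [x], descend to a function whose nonzero difference at 0 has least valuation. *)
have [z [Oz nz zmin]] : exists z, [/\ O z, diff b z 0%N != 0 &
    forall y, O y -> diff b y 0%N != 0 -> (v (diff b z 0%N) <= v (diff b y 0%N))%N].
  have nx' : diff b x 0%N != 0 by rewrite /diff subr_eq0.
  move E: (v (diff b x 0%N)) => t.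
  elim/ltn_ind: t x Ox nx nx' E => t IH x Ox nx nx' E.
  have [[y [Oy ny lt]]|H] := classic (exists y,
    [/\ O y, diff b y 0%N != 0 & (v (diff b y 0%N) < t)%N]).
    by apply: (IH _ lt y Oy _ ny erefl); move: ny; rewrite /diff subr_eq0.
  exists x; split=> // y Oy ny; rewrite E leqNgt; apply/negP => lt.
  by apply: H; exists y.
set dl' := v (diff b z 0%N) in zmin.
(* By minimality [dl] may be raised to the exact valuation [dl']; the condition on [c] does not
   involve it. *)
have hn' : near_id pi O b c dl'.
  split; last by case: hn.
  move=> y Oy; have [->|ny] := eqVneq (diff b y 0%N) 0; first exact: pi_dvd0.
  by apply: val_pi_dvd; apply: zmin.
have le : (dl <= dl')%N by apply: pi_dvd_val => //; case: hn => h _; apply: h.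
have d0' : (0 < dl')%N by apply: leq_trans le.
have zp : diff (p * b) z 0%N = 0.
  by rewrite /diff add0n mulnA -expnS per // subrr.
(* The element p D z (0) has valuation exactly [w + dl'], so cancelling [dl'] leaves min((p - 1) c,
   dl') <= w. *)
have := near_id_last hO pp pw c0 d0' hn' Oz zp.
move=> /pi_dvd_val; rewrite mulf_neq0 // dvr_valM // -/dl' => /(_ isT) h.
have p1 := prime_gt1 pp.
case: (p =P 2%N) hc h => [->|/eqP p2] [h1 h2] h.
  by rewrite fibSS in h2; have := leq_fib e; rewrite mul1n in h; lia.
have h3 : (2 * c <= p.-1 * c)%N by rewrite leq_mul2r; lia.
by lia.
Qed.

End Valuation.

(** * Logarithmic bounds *)

Section LogBounds.
Local Open Scope R_scope.

Lemma le_logb b x (n : nat) : 1 < b -> b ^ n <= x -> INR n <= logb b x.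
Proof.
move=> b1 h; have lb : 0 < ln b by rewrite -ln_1; apply: ln_increasing; lra.
have bn : 0 < b ^ n by apply: pow_lt; lra.
rewrite /logb; apply: (Rmult_le_reg_r (ln b)) => //.
rewrite /Rdiv Rmult_assoc Rinv_l; last lra.
rewrite Rmult_1_r -ln_pow; last lra.
by case: h => [h|<-]; [left; apply: ln_increasing|right].
Qed.

Lemma golden_gt1 : 1 < golden.
Proof.
rewrite /golden; have : 1 < sqrt 5 by rewrite -sqrt_1; apply: sqrt_lt_1; lra.
by lra.
Qed.

(** Both sides satisfy the Fibonacci recursion, so the induction carries two consecutive indices. *)
Lemma golden_pow_fib n : golden ^ n <= sqrt 5 * INR (fib n.+1).
Proof.
have h5 : 2 < sqrt 5.
  rewrite -(sqrt_square 2); last lra.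
  by apply: sqrt_lt_1; lra.
have s5 : sqrt 5 * sqrt 5 = 5 by apply: sqrt_sqrt; lra.
have g2 : golden * golden = golden + 1 by rewrite /golden; lra.
suff [] : golden ^ n <= sqrt 5 * INR (fib n.+1) /\
          golden ^ n.+1 <= sqrt 5 * INR (fib n.+2) by [].
elim: n => [|n [h1 h2]].
  rewrite /= Rmult_1_r; split; first lra.
  by rewrite /golden; lra.
split=> //; rewrite fibSS plus_INR Rmult_plus_distr_l.
have -> : golden ^ n.+2 = golden ^ n.+1 + golden ^ n.
  by rewrite /= -Rmult_assoc g2; lra.
by lra.
Qed.

Lemma log2_bound e w : (2 ^ e <= w)%N -> INR e.+1 <= 1 + logb 2 (INR w).
Proof.
move=> h; rewrite S_INR Rplus_comm; apply: Rplus_le_compat_l.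
apply: le_logb; first lra.
have -> : 2 ^ e = INR (expn 2 e).
  by elim: e {h} => // e IH; rewrite expnS mult_INR -IH.
by apply: le_INR; apply/leP.
Qed.

(** The argument of the logarithm is the mean of sqrt 5 * w and a number at least as large, hence at
    least sqrt 5 * w, which bounds [golden ^ e]. *)
Lemma golden_bound e w : (fib e.+1 <= w)%N ->
  INR e.+1 <= 1 + logb golden ((sqrt 5 * INR w + sqrt (5 * INR w ^ 2 + 4)) / 2).
Proof.
move=> h; rewrite S_INR Rplus_comm; apply: Rplus_le_compat_l.
apply: le_logb; first exact: golden_gt1.
have w0 := pos_INR w.
have h1 : golden ^ e <= sqrt 5 * INR w.
  apply: Rle_trans (golden_pow_fib e) _; apply: Rmult_le_compat_l.
    exact: sqrt_pos.
  by apply: le_INR; apply/leP.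
have h2 : sqrt 5 * INR w <= sqrt (5 * INR w ^ 2 + 4).
  rewrite -[X in _ * X <= _]sqrt_pow2 // -sqrt_mult; [|lra|exact: pow_le].
  by apply: sqrt_le_1_alt; lra.
by lra.
Qed.

End LogBounds.

(** * Homogeneous forms *)

Section HomogeneousForms.
Variables (A : comNzRingType) (n : nat).
Implicit Types (f g : {mpoly A[n]}) (G : n.-tuple {mpoly A[n]}).

Lemma dhomog_mevalZ d f (u : A) (a b : 'I_n -> A) : f \is d.-homog ->
  (forall i, b i = u * a i) -> f.@[b] = u ^+ d * f.@[a].
Proof.
move=> hf e; rewrite !mevalE mulr_sumr; apply: eq_big_seq => mu mf.
rewrite mulrCA; congr (_ * _).
under eq_bigr do rewrite e exprMn.
rewrite big_split /= prodrXr; congr (_ ^+ _ * _).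
by rewrite -mdegE (dhomog_mf hf mf).
Qed.

Lemma dhomog_X j : ('X_j : {mpoly A[n]}) \is 1.-homog.
Proof. by rewrite dhomogX /= mdeg1. Qed.

Lemma dhomog_comp d D f G : f \is d.-homog ->
  (forall j, tnth G j \is D.-homog) -> f \mPo G \is (D * d).-homog.
Proof.
move=> hf hG; rewrite comp_mpolyE big_seq; apply: rpred_sum => mu mf.
have hd : mdeg mu = d := dhomog_mf hf mf.
apply: dhomogZ; rewrite -hd mdegE big_distrr /=.
elim/big_rec2: _ => [|i x y _ hy]; first exact: dhomog1.
by apply: dhomogM => //; apply: dhomogMn.
Qed.

Lemma iter_comp_dhomog r d D f G : f \is d.-homog ->
  (forall j, tnth G j \is D.-homog) ->
  iter r (comp_mpoly G) f \is (D ^ r * d).-homog.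
Proof.
move=> hf hG; elim: r => [|r IH]; first by rewrite mul1n.
by rewrite iterS expnS -mulnA; apply: dhomog_comp.
Qed.

Variables (B : comNzRingType) (red : {rmorphism A -> B}).

Definition map_forms G : n.-tuple {mpoly B[n]} :=
  [tuple map_mpoly red (tnth G j) | j < n].

Lemma map_mpoly_homog d f : f \is d.-homog -> map_mpoly red f \is d.-homog.
Proof.
move=> hf; apply/dhomogP => mu; rewrite mcoeff_msupp mcoeff_map_mpoly => nz.
apply: (dhomog_mf hf); rewrite mcoeff_msupp.
by apply: contra_neq nz => ->; rewrite raddf0.
Qed.

Lemma map_mpoly_sum f :
  map_mpoly red f = \sum_(mu <- msupp f) red f@_mu *: 'X_[mu].
Proof.
rewrite {1}[f]mpolyE rmorph_sum; apply: eq_bigr => mu _ /=.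
by rewrite map_mpolyZ map_mpolyX.
Qed.

Lemma meval_map_mpoly f (a : 'I_n -> A) :
  (map_mpoly red f).@[fun i => red (a i)] = red f.@[a].
Proof.
rewrite map_mpoly_sum [in RHS]mevalE !rmorph_sum; apply: eq_bigr => mu _ /=.
rewrite mevalZ mevalX rmorphM rmorph_prod.
by congr (_ * _); apply: eq_bigr => i _; rewrite rmorphXn.
Qed.

Lemma map_mpoly_mPo f G :
  map_mpoly red (f \mPo G) = map_mpoly red f \mPo map_forms G.
Proof.
rewrite [map_mpoly red f]map_mpoly_sum comp_mpolyE !rmorph_sum.
apply: eq_bigr => mu _ /=.
rewrite map_mpolyZ comp_mpolyZ rmorph_prod comp_mpolyX; congr (_ *: _).
by apply: eq_bigr => i _; rewrite rmorphXn tnth_mktuple.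
Qed.

Lemma map_mpoly_iter r f G :
  map_mpoly red (iter r (comp_mpoly G) f) =
  iter r (comp_mpoly (map_forms G)) (map_mpoly red f).
Proof. by elim: r => //= r <-; rewrite map_mpoly_mPo. Qed.

End HomogeneousForms.

(** * Lifting forms from the residue field, and forms that reduce to zero *)

Section ReductionOfForms.
Variables (R : idomainType) (v : R -> nat) (pi : R) (n : nat).
Variables (k : finFieldType) (red : {rmorphism R -> k}).
Hypotheses (hdvr : normalized_dvr v) (pi0 : pi != 0) (vpi : v pi = 1%N).
Hypothesis hred : residue_map v red.

(** Lifting coefficients only on the support keeps the degree; finiteness of [k] gives a section of
    [red] without a choice axiom. *)
Lemma lift_homog d (f : {mpoly k[n]}) : f \is d.-homog ->
  exists2 f0 : {mpoly R[n]}, f0 \is d.-homog & map_mpoly red f0 = f.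
Proof.
move=> hf; case: (hred) => /(@fin_all_exists k (fun=> R)) [s hs] _.
exists (\sum_(mu <- msupp f) s f@_mu *: 'X_[mu]).
  rewrite big_seq; apply: rpred_sum => mu mf; apply: dhomogZ.
  by rewrite dhomogX (dhomog_mf hf mf).
rewrite rmorph_sum [f in RHS]mpolyE; apply: eq_bigr => mu _ /=.
by rewrite map_mpolyZ map_mpolyX hs.
Qed.

Lemma map_mpoly_eq0_homog d (f : {mpoly R[n]}) : f \is d.-homog ->
  map_mpoly red f = 0 -> exists2 f', f' \is d.-homog & f = pi *: f'.
Proof.
move=> hf f0; rewrite [f]mpolyE.
have : {subset msupp f <= msupp f} by [].
elim: {1 3}(msupp f) => [_|mu s IH hs].
  by exists 0; rewrite ?dhomog0 // big_nil scaler0.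
have [t ht e] : exists2 f', f' \is d.-homog &
    \sum_(nu <- s) f@_nu *: 'X_[nu] = pi *: f'.
  by apply: IH => nu hnu; apply: hs; rewrite inE hnu orbT.
have [c hc] : pi_dvd pi 1 f@_mu.
  apply/(red_eq0 hdvr pi0 vpi hred).
  by rewrite -mcoeff_map_mpoly f0 mcoeff0.
exists (c *: 'X_[mu] + t); last by rewrite big_cons e hc expr1 scalerDr scalerA.
apply: dhomogD => //; apply: dhomogZ; rewrite dhomogX.
by rewrite (dhomog_mf hf) // hs // mem_head.
Qed.

End ReductionOfForms.

(** * Morphisms and their reductions *)

Section LocalMorphism.
Variables (R : idomainType) (k : fieldType) (red : {rmorphism R -> k}) (n : nat).
Hypothesis unit_red : forall x, (x \is a GRing.unit) = (red x != 0).
Variables (eqs : seq {mpoly R[n]}) (phi : seq (n.-tuple {mpoly R[n]})).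
Hypothesis hphi : is_morphism eqs phi.
Implicit Types a b P : 'I_n -> R.

Definition same_reduction a b : Prop :=
  exists2 u : k, u != 0 & forall i, red (b i) = u * red (a i).

Lemma same_reduction_trans a b c :
  same_reduction a b -> same_reduction b c -> same_reduction a c.
Proof.
move=> [u u0 hu] [w w0 hw]; exists (w * u); first by rewrite mulf_neq0.
by move=> i; rewrite hw hu mulrA.
Qed.

Lemma red_meval_same d (f : {mpoly R[n]}) a b u : f \is d.-homog ->
  (forall i, red (b i) = u * red (a i)) -> red f.@[b] = u ^+ d * red f.@[a].
Proof.
move=> hf e; rewrite -!meval_map_mpoly.
exact: (dhomog_mevalZ (map_mpoly_homog red hf)).
Qed.

Lemma unit_meval_same d (f : {mpoly R[n]}) a b : f \is d.-homog ->
  same_reduction a b ->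
  (f.@[a] \is a GRing.unit) = (f.@[b] \is a GRing.unit).
Proof.
move=> hf [u u0 e]; rewrite !unit_red (red_meval_same hf e).
by rewrite mulf_eq0 expf_eq0 (negbTE u0) andbF.
Qed.

(** The selected tuple depends only on which forms take unit values, and this is visible on the
    reduced point. *)
Lemma local_rep_same a b :
  same_reduction a b -> local_rep phi a = local_rep phi b.
Proof.
move=> hab; rewrite /local_rep; congr (nth _ _ _); apply: eq_in_find => F hF.
case: hphi => /(_ _ hF) [d hd] _ _ _.
by apply: eq_existsb => j; apply: unit_meval_same (hd j) hab.
Qed.

(** If every entry of every tuple reduced to 0 at [a], the covering relation for a power of ['X_i]
    would make the unit [a i] reduce to 0. *)
Lemma has_local_rep a : proj_point eqs a ->
  has (fun F : n.-tuple {mpoly R[n]} =>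
    [exists j, (tnth F j).@[a] \is a GRing.unit]) phi.
Proof.
move=> [[i ui] ha]; apply/negPn/negP => /hasPn none.
case: hphi => _ [M /(_ i) [c e]] _ _.
have : red ('X_i ^+ M).@[a] = 0.
  rewrite e [_.@[a]]rmorph_sum rmorph_sum big1 // => j _; rewrite /= mevalM rmorphM.
  set s := eqs ++ _ in j *.
  have : s`_j \in s by apply: mem_nth.
  rewrite mem_cat => /orP [/ha -> |]; first by rewrite rmorph0 mulr0.
  move=> /flattenP [t /mapP [F hF ->]] /tnthP [l ->].
  have /existsPn /(_ l) := none F hF.
  by rewrite unit_red negbK => /eqP ->; rewrite mulr0.
move/eqP; rewrite [_.@[a]]rmorphXn /= mevalXU rmorphXn expf_eq0 => /andP [_].
by apply/negP; rewrite -unit_red.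
Qed.

Lemma local_rep_mem a : proj_point eqs a -> local_rep phi a \in phi.
Proof. by move=> /has_local_rep h; apply: mem_nth; rewrite -has_find. Qed.

Lemma local_rep_unit a : proj_point eqs a ->
  exists j, mor_eval phi a j \is a GRing.unit.
Proof. by move=> /has_local_rep h; apply/existsP; apply: (nth_find _ h). Qed.

Lemma local_rep_homog a : proj_point eqs a ->
  exists d, forall j, tnth (local_rep phi a) j \is d.-homog.
Proof. by case: hphi => h _ _ _ /local_rep_mem; apply: h. Qed.

Lemma mor_proj_point a : proj_point eqs a -> proj_point eqs (mor_eval phi a).
Proof.
move=> ha; have [j uj] := local_rep_unit ha; split; first by exists j.
move=> h hh; case: hphi => _ _ _ /(_ _ (local_rep_mem ha) h hh j).
(* Evaluated at [a], the factor defining the open set is a unit and can be cancelled. *)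
case: (ha) => [[i ui] hz] /(_ i) [M [c e]].
have : (('X_i * tnth (local_rep phi a) j) ^+ M * (h \mPo local_rep phi a)).@[a] = 0.
  rewrite e [_.@[a]]rmorph_sum big1 // => l _; rewrite /= mevalM.
  by rewrite (hz _ (mem_nth 0 (ltn_ord l))) mulr0.
rewrite mevalM [(_ ^+ M).@[a]]rmorphXn /= mevalM mevalXU comp_mpoly_meval => e0.
have uM : (a i * mor_eval phi a j) ^+ M \is a GRing.unit.
  by rewrite unitrX // unitrM ui.
by apply: (mulrI uM); rewrite mulr0.
Qed.

Lemma iter_proj_point a i :
  proj_point eqs a -> proj_point eqs (iter i (mor_eval phi) a).
Proof. by move=> ha; elim: i => //= i; apply: mor_proj_point. Qed.

Lemma mor_same_reduction a b : proj_point eqs a -> same_reduction a b ->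
  same_reduction (mor_eval phi a) (mor_eval phi b).
Proof.
move=> ha hab; have [d hd] := local_rep_homog ha.
have e := local_rep_same hab; case: hab => u u0 hu.
exists (u ^+ d); first by rewrite expf_neq0.
by move=> i; rewrite /mor_eval -e; apply: red_meval_same.
Qed.

Lemma same_point_meval0 d (f : {mpoly R[n]}) a b : f \is d.-homog ->
  same_point a b -> f.@[a] = 0 -> f.@[b] = 0.
Proof. by move=> hf [u _ e] h; rewrite (dhomog_mevalZ hf e) h mulr0. Qed.

Lemma same_point_reduction a b : same_point a b -> same_reduction a b.
Proof.
move=> [u uu e]; exists (red u); first by rewrite -unit_red.
by move=> i; rewrite e rmorphM.
Qed.

Lemma mor_same_point a b : proj_point eqs a -> same_point a b ->
  same_point (mor_eval phi a) (mor_eval phi b).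
Proof.
move=> ha hab; have [d hd] := local_rep_homog ha.
have e := local_rep_same (same_point_reduction hab); case: hab => u uu hu.
exists (u ^+ d); first by rewrite unitrX.
by move=> i; rewrite /mor_eval -e; apply: dhomog_mevalZ.
Qed.

Lemma iter_same_point i a b : proj_point eqs a -> same_point a b ->
  same_point (iter i (mor_eval phi) a) (iter i (mor_eval phi) b).
Proof.
move=> ha hab; elim: i => //= i IH.
by apply: mor_same_point => //; apply: iter_proj_point.
Qed.

Lemma iter_same_reduction i a b : proj_point eqs a -> same_reduction a b ->
  same_reduction (iter i (mor_eval phi) a) (iter i (mor_eval phi) b).
Proof.
move=> ha hab; elim: i => //= i IH.
by apply: mor_same_reduction => //; apply: iter_proj_point.
Qed.

Lemma local_rep_map a : proj_point eqs a ->
  local_rep (map_mor red phi) (fun i => red (a i)) = map_forms red (local_rep phi a).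
Proof.
move=> /has_local_rep h; rewrite {1}/local_rep /map_mor find_map.
set p1 := preim _ _; set p0 := fun F : n.-tuple {mpoly R[n]} => _ in h.
have -> : find p1 phi = find p0 phi.
  apply: eq_find => F; apply: eq_existsb => j.
  by rewrite tnth_mktuple meval_map_mpoly unitfE unit_red.
by rewrite (nth_map [tuple 'X_i | i < n]) // -has_find.
Qed.

Lemma mor_eval_map a : proj_point eqs a ->
  mor_eval (map_mor red phi) (fun i => red (a i)) = fun i => red (mor_eval phi a i).
Proof.
move=> ha; apply: functional_extensionality => j.
by rewrite /mor_eval local_rep_map // tnth_mktuple meval_map_mpoly.
Qed.

Lemma iter_mor_map i a : proj_point eqs a ->
  iter i (mor_eval (map_mor red phi)) (fun j => red (a j)) =
  fun j => red (iter i (mor_eval phi) a j).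
Proof.
move=> ha; elim: i => //= i ->.
by rewrite mor_eval_map //; apply: iter_proj_point.
Qed.

Lemma iter_rep_map i a : proj_point eqs a ->
  iter_rep (map_mor red phi) i (fun j => red (a j)) =
  map_forms red (iter_rep phi i a).
Proof.
move=> ha; elim: i => [|i IH]; apply: eq_from_tnth => j.
  by rewrite !tnth_mktuple map_mpolyX.
rewrite /= !tnth_mktuple (iter_mor_map i ha).
rewrite (local_rep_map (iter_proj_point i ha)).
by rewrite tnth_mktuple IH map_mpoly_mPo.
Qed.

Lemma iter_rep_homog i a : proj_point eqs a ->
  exists D, forall j, tnth (iter_rep phi i a) j \is D.-homog.
Proof.
move=> ha; elim: i => [|i [D hD]].
  by exists 1%N => j; rewrite tnth_mktuple dhomog_X.
have [d hd] := local_rep_homog (iter_proj_point i ha).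
by exists (D * d)%N => j; rewrite tnth_mktuple; apply: dhomog_comp.
Qed.

(** A tuple built at [a] works at every [b] with the same reduction, so a single tuple moves each
    Q_i to Q_(i+1). *)
Lemma iter_rep_meval i a b : proj_point eqs a -> same_reduction a b ->
  forall j, (tnth (iter_rep phi i a) j).@[b] = iter i (mor_eval phi) b j.
Proof.
move=> ha hab; elim: i => [|i IH] j; first by rewrite tnth_mktuple mevalXU.
rewrite tnth_mktuple comp_mpoly_meval iterS.
rewrite (local_rep_same (iter_same_reduction i ha hab)).
exact: meval_eq.
Qed.

Lemma iter_mul_same_reduction m i a : proj_point eqs a ->
  same_reduction a (iter m (mor_eval phi) a) ->
  same_reduction a (iter (m * i) (mor_eval phi) a).
Proof.
move=> ha h; elim: i => [|i IH].
  by rewrite muln0; exists 1; rewrite ?oner_neq0 // => j; rewrite mul1r.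
rewrite mulnS addnC iterD; apply: same_reduction_trans IH _.
by apply: iter_same_reduction.
Qed.

End LocalMorphism.

(** * The ring of functions on the orbit *)

Section LocalRing.
Variables (R : idomainType) (v : R -> nat) (pi : R) (n : nat).
Variables (k : finFieldType) (red : {rmorphism R -> k}).
Hypotheses (hdvr : normalized_dvr v) (pi0 : pi != 0) (vpi : v pi = 1%N).
Hypothesis hred : residue_map v red.
Variables (Q : nat -> 'I_n -> R) (G : n.-tuple {mpoly R[n]}) (D : nat).
Hypotheses (hQ : forall i, same_reduction red (Q 0%N) (Q i))
  (hG : forall j, tnth G j \is D.-homog)
  (QG : forall i j, (tnth G j).@[Q i] = Q i.+1 j).
Implicit Types (f g : {mpoly R[n]}) (h : nat -> R).
Local Notation tofrac := (@FracField.tofrac {mpoly k[n]}).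
Implicit Types u w : {fraction {mpoly k[n]}}.

Let ured := unit_red hdvr pi0 vpi hred.

(* [h] is the sequence of values at the points Q_i of a section f/g of the local
   ring of projective space over R at the common reduction of these points, and
   [u] is the reduction of f/g. *)
Definition ratio u h : Prop := exists d f g,
  [/\ f \is d.-homog, g \is d.-homog, g.@[Q 0%N] \is a GRing.unit,
      u = tofrac (map_mpoly red f) / tofrac (map_mpoly red g)
    & forall i, h i * g.@[Q i] = f.@[Q i]].

Definition orbit_fun h : Prop := exists u, ratio u h.

Lemma meval_orbit_unit d g i : g \is d.-homog -> g.@[Q 0%N] \is a GRing.unit ->
  g.@[Q i] \is a GRing.unit.
Proof. by move=> hg; rewrite -(unit_meval_same ured hg (hQ i)). Qed.

Let redFD f g : tofrac (map_mpoly red (f + g)) =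
  tofrac (map_mpoly red f) + tofrac (map_mpoly red g).
Proof. by rewrite raddfD tofracD. Qed.

Let redFM f g : tofrac (map_mpoly red (f * g)) =
  tofrac (map_mpoly red f) * tofrac (map_mpoly red g).
Proof. by rewrite (rmorphM (map_mpoly red)) tofracM. Qed.

Lemma red_unit_neq0 (a : 'I_n -> R) g :
  g.@[a] \is a GRing.unit -> tofrac (map_mpoly red g) != 0.
Proof.
rewrite ured tofrac_eq0; apply: contra_neq => e.
by rewrite -meval_map_mpoly e meval0.
Qed.

Lemma ratio_quot d f g : f \is d.-homog -> g \is d.-homog ->
  g.@[Q 0%N] \is a GRing.unit ->
  ratio (tofrac (map_mpoly red f) / tofrac (map_mpoly red g))
        (fun i => f.@[Q i] / g.@[Q i]).
Proof.
move=> hf hg ug; exists d, f, g; split=> // i.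
by rewrite divrK //; apply: meval_orbit_unit hg ug.
Qed.

Lemma ratio_ext u h h' : h =1 h' -> ratio u h -> ratio u h'.
Proof.
move=> e [d [f [g [hf hg ug eu eh]]]]; exists d, f, g; split=> // i.
by rewrite -e.
Qed.

Lemma ratio_const (c : R) : ratio (tofrac (red c)%:MP) (fun=> c).
Proof.
exists 0%N, c%:MP, 1; split.
- by rewrite -[c%:MP]mulr1 mul_mpolyC; apply: dhomogZ; apply: dhomog1.
- exact: dhomog1.
- by rewrite meval1 unitr1.
- by rewrite map_mpolyC rmorph1 tofrac1 divr1.
- by move=> i; rewrite meval1 mevalC mulr1.
Qed.

Lemma ratioD u w h h' : ratio u h -> ratio w h' ->
  ratio (u + w) (fun i => h i + h' i).
Proof.
move=> [d [f [g [hf hg ug -> eh]]]] [d' [f' [g' [hf' hg' ug' -> eh']]]].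
exists (d + d')%N, (f * g' + f' * g), (g * g'); split.
- by apply: dhomogD; [|rewrite addnC]; apply: dhomogM.
- exact: dhomogM.
- by rewrite mevalM unitrM ug.
- rewrite redFD !redFM; exact: addf_div (red_unit_neq0 ug) (red_unit_neq0 ug').
- by move=> i; rewrite mevalD !mevalM -eh -eh'; ring.
Qed.

Lemma ratioM u w h h' : ratio u h -> ratio w h' ->
  ratio (u * w) (fun i => h i * h' i).
Proof.
move=> [d [f [g [hf hg ug -> eh]]]] [d' [f' [g' [hf' hg' ug' -> eh']]]].
exists (d + d')%N, (f * f'), (g * g'); split.
- exact: dhomogM.
- exact: dhomogM.
- by rewrite mevalM unitrM ug.
- by rewrite !redFM mulf_div.
- by move=> i; rewrite !mevalM -eh -eh'; ring.
Qed.

Lemma ratioB u w h h' : ratio u h -> ratio w h' ->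
  ratio (u - w) (fun i => h i - h' i).
Proof.
move=> hu hw; have := ratioD hu (ratioM (ratio_const (-1)) hw).
rewrite rmorphN rmorph1 mpolyCN tofracN tofrac1 mulN1r.
by apply: ratio_ext => i; rewrite mulN1r.
Qed.

Lemma iter_comp_meval r f i :
  (iter r (comp_mpoly G) f).@[Q i] = f.@[Q (i + r)%N].
Proof.
elim: r i => [|r IH] i; first by rewrite addn0.
rewrite iterS comp_mpoly_meval addnS -addSn -IH.
exact/meval_eq/QG.
Qed.

Lemma ratio_iter r d f g h : f \is d.-homog -> g \is d.-homog ->
  g.@[Q 0%N] \is a GRing.unit -> (forall i, h i * g.@[Q i] = f.@[Q i]) ->
  ratio (tofrac (map_mpoly red (iter r (comp_mpoly G) f)) /
         tofrac (map_mpoly red (iter r (comp_mpoly G) g))) (fun i => h (i + r)%N).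
Proof.
move=> hf hg ug eh; exists (D ^ r * d)%N.
exists (iter r (comp_mpoly G) f), (iter r (comp_mpoly G) g).
split=> //; try exact: iter_comp_dhomog.
- by rewrite iter_comp_meval; apply: meval_orbit_unit hg ug.
- by move=> i; rewrite !iter_comp_meval.
Qed.

(** The numerator reduces to the zero form, so [pi] divides it as a form. *)
Lemma ratio0_pi h : ratio 0 h ->
  exists2 h', orbit_fun h' & forall i, h i = pi * h' i.
Proof.
move=> [d [f [g [hf hg ug /esym/eqP]]]].
rewrite mulf_eq0 invr_eq0 (negbTE (red_unit_neq0 ug)) orbF tofrac_eq0.
move=> /eqP /(map_mpoly_eq0_homog hdvr pi0 vpi hred hf) [f' hf' ->] eh.
have := ratio_quot hf' hg ug; set h' := fun i => _ => hr.
exists h'; first by eexists; apply: hr.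
move=> i; apply: (mulIr (meval_orbit_unit i hg ug)).
by rewrite eh mevalZ -mulrA divrK //; apply: meval_orbit_unit hg ug.
Qed.

Lemma orbit_fun_ring : shift_ring orbit_fun.
Proof.
split.
- by move=> x y e [u hu]; exists u; apply: ratio_ext hu.
- by move=> c; eexists; apply: ratio_const.
- by move=> x y [u hu] [w hw]; eexists; apply: ratioD hu hw.
- by move=> x y [u hu] [w hw]; eexists; apply: ratioM hu hw.
- move=> x [u [d [f [g [hf hg ug _ eh]]]]]; eexists.
  apply: ratio_ext _ (ratio_iter 1 hf hg ug eh) => i.
  by rewrite addn1.
Qed.

(** All Q_i have the same reduction, and the scalars cancel because numerator and denominator have
    equal degree. *)
Lemma orbit_fun_pi_dvd h i : orbit_fun h -> pi_dvd pi 1 (h i - h 0%N).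
Proof.
move=> [u [d [f [g [hf hg ug _ eh]]]]].
apply/(red_eq0 hdvr pi0 vpi hred); rewrite rmorphB.
have [c c0 ec] := hQ i.
have := congr1 red (eh i); have := congr1 red (eh 0%N).
rewrite !rmorphM (red_meval_same hf ec) (red_meval_same hg ec) => <-.
rewrite mulrCA => /(mulfI (expf_neq0 d c0)) e.
apply/eqP; rewrite subr_eq0; apply/eqP; apply: mulIf e.
by rewrite -ured.
Qed.

Local Notation z := (fun j => red (Q 0%N j)).

Lemma max_ideal_ratio u : max_ideal z u ->
  exists h, ratio u h /\ pi_dvd pi 1 (h 0%N).
Proof.
move=> [d [f [g [[hf hg gz fz] ->]]]].
have [f0 hf0 ef] := lift_homog hred hf; have [g0 hg0 eg] := lift_homog hred hg.
have ug : g0.@[Q 0%N] \is a GRing.unit by rewrite ured -meval_map_mpoly eg.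
eexists; rewrite -ef -eg; split; first exact: ratio_quot hf0 hg0 ug.
apply/(red_eq0 hdvr pi0 vpi hred); rewrite /= rmorphM.
by rewrite -meval_map_mpoly ef fz mul0r.
Qed.

(** Elements of m_z lift to functions whose value at Q_0 is only divisible by [pi], so their
    products are handled by [lin_mul_dvd]. *)
Lemma max_ideal_sq_ratio t : max_ideal_sq z t ->
  exists h, ratio t h /\ lin pi orbit_fun 1 h.
Proof.
move=> [s hs ->]; elim: s hs => [_|[a b] s IH hs].
  exists (fun=> 0); rewrite big_nil; split.
    by have := ratio_const 0; rewrite rmorph0 mpolyC0 tofrac0.
  exact: (lin_const pi orbit_fun 1 (r := 0)).
have [h [hr hl]] : exists h, ratio (\sum_(ab <- s) ab.1 * ab.2) h /\
    lin pi orbit_fun 1 h.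
  by apply: IH => ab hab; apply: hs; rewrite inE hab orbT.
have [/max_ideal_ratio [ha [ra da]] /max_ideal_ratio [hb [rb db]]] :=
  hs (a, b) (mem_head _ _).
exists (fun i => ha i * hb i + h i); rewrite big_cons; split.
  by apply: ratioD hr; apply: ratioM.
apply: (lin_add (lin_mul_dvd orbit_fun_ring _ _ da db) hl) => //.
- by exists a.
- by exists b.
Qed.

Variables (J : nat -> {mpoly R[n]} -> Prop) (r : nat).
Hypotheses (hJ : forall d f, J d f -> f \is d.-homog /\ forall i, f.@[Q i] = 0)
  (hr : cotangent_power_id (base_change_form red J) z (map_forms red G) r).

(** Sections of the ideal of the orbit have zero values, so they can be subtracted from a class
    without changing the function. *)
Lemma ideal_stalk_ratio u : ideal_stalk (base_change_form red J) z u ->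
  ratio u (fun=> 0).
Proof.
move=> [d [f [g [[f0 /hJ [hf0 f0Q] ->] hg gz ->]]]].
have [g0 hg0 eg] := lift_homog hred hg.
have ug : g0.@[Q 0%N] \is a GRing.unit by rewrite ured -meval_map_mpoly eg.
rewrite -eg; apply: ratio_ext (ratio_quot hf0 hg0 ug) => i.
by rewrite f0Q mul0r.
Qed.

Lemma near_id_orbit_fun : near_id pi orbit_fun r 1 1.
Proof.
split=> h Oh; first by rewrite /diff add0n; apply: orbit_fun_pi_dvd.
case: (Oh) => _ [d [f [g [hf hg ug _ eh]]]].
set c := h 0%N.
(* Subtracting the constant [c] puts the reduced quotient in m_z and leaves the differences
   unchanged. *)
have hf' : f - c *: g \is d.-homog.
  by rewrite -scaleN1r; apply: dhomogD => //; do 2!apply: dhomogZ.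
have eh' i : (h i - c) * g.@[Q i] = (f - c *: g).@[Q i].
  by rewrite mevalB mevalZ -eh; ring.
have hmax : max_rep z d (map_mpoly red (f - c *: g)) (map_mpoly red g).
  split.
  - exact: map_mpoly_homog.
  - exact: map_mpoly_homog.
  - by rewrite meval_map_mpoly -ured.
  - by rewrite meval_map_mpoly -eh' subrr mul0r raddf0.
have [t ht hst] := hr hmax.
have [q [hq lq]] := max_ideal_sq_ratio ht.
have R1 := ratio_iter r hf' hg ug eh'.
have R0 : ratio (tofrac (map_mpoly red (f - c *: g)) / tofrac (map_mpoly red g))
            (fun i => h i - c) by exists d, (f - c *: g), g.
rewrite !map_mpoly_iter in R1.
(* After removing the m_z^2 part [q] and the ideal part, the class is 0, so what remains of D h is a
   multiple of [pi]. *)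
have R2 := ratioB (ratioB (ratioB R1 R0) hq) (ideal_stalk_ratio hst).
rewrite subrr in R2.
have [h' Oh' e] := ratio0_pi R2.
apply: (lin_add lq (lin_pi (c := 1) (y := fun i => pi * h' i) Oh' (fun=> erefl))) => i.
by rewrite -e /diff; ring.
Qed.

End LocalRing.

(** * Application to the orbit of P under phi^m *)

Theorem theorem2
  (R : idomainType) (v : R -> nat)
  (k : finFieldType) (red : {rmorphism R -> k}) (p : nat)
  (N d : nat) (eqs : seq {mpoly R[N.+1]})
  (phi : seq (N.+1.-tuple {mpoly R[N.+1]})) (P : 'I_N.+1 -> R)
  (n m rV e : nat)
  (hdvr : normalized_dvr v) (hcomplete : val_complete v)
  (hred : residue_map v red) (hchar : p \in [pchar k])
  (hhom : homogeneous_eqs eqs) (hsmooth : proj_smooth eqs)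
  (hX : nonsingular_irreducible_variety
          [seq map_mpoly (@FracField.tofrac R) h | h <- eqs] d)
  (hphi : is_morphism eqs phi)
  (hP : proj_point eqs P)
  (hn : primitive_period phi P n)
  (hm : primitive_period (map_mor red phi) (fun i => red (P i)) m)
  (hrV : cotangent_order (base_change_form red (orbit_union_form phi P n))
           (fun i => red (P i))
           (iter_rep (map_mor red phi) m (fun i => red (P i))) rV)
  (hnmr : n = (m * rV * p ^ e)%N)
  (hp : p%:R != 0 :> R) :
  (p <> 2%N ->
     (INR e <= 1 + logb 2 (INR (v p%:R%R)))%Re) /\
  (p = 2%N ->
     (INR e <= 1 + logb golden
        ((sqrt 5 * INR (v 2%:R%R) + sqrt (5 * INR (v 2%:R%R) ^ 2 + 4)) / 2))%Re).
Proof.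
have pp : prime p := pcharf_prime hchar.
case: (hdvr) => _ _ [pi pi0 vpi] _.
have ured := unit_red hdvr pi0 vpi hred.
have w1 : (1 <= v p%:R)%N.
  apply: (pi_dvd_val hdvr pi0 vpi hp); apply/(red_eq0 hdvr pi0 vpi hred).
  by rewrite rmorph_nat (pcharf0 hchar).
(* With e = f + 1 the bound is on f; for e = 0 the fact v(p) >= 1 makes the logarithms
   nonnegative. *)
suff hf f : e = f.+1 ->
    if p == 2 then (fib f.+1 <= v p%:R)%N else (2 ^ f <= v p%:R)%N.
  case: e hnmr hf => [|f] _ hf.
    split=> [_|p2].
      by apply: Rle_trans (log2_bound (e := 0) w1); apply: pos_INR.
    rewrite p2 in w1.
    by apply: Rle_trans (golden_bound (e := 0) w1); apply: pos_INR.
  have {}hf := hf f erefl; split=> [p2|p2].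
    by move: hf; case: eqP => // _; apply: log2_bound.
  by move: hf; rewrite p2 eqxx; apply: golden_bound.
move=> ef; rewrite {}ef in hnmr *.
have [n0 [un uun enP] nmin] := hn; have [m0 [um umu emP] _] := hm.
have [r0 hr _] := hrV.
set mor := mor_eval phi; pose Q i := iter (m * i) mor P.
have hQ i : same_reduction red (Q 0%N) (Q i).
  rewrite /Q muln0; apply: (iter_mul_same_reduction ured hphi) => //.
  exists um^-1; first by rewrite invr_eq0 -unitfE.
  by move=> j; rewrite (emP j) (iter_mor_map ured hphi) // mulKr.
have [D hD] := iter_rep_homog ured hphi m hP.
have QG i j : (tnth (iter_rep phi m P) j).@[Q i] = Q i.+1 j.
  rewrite (iter_rep_meval ured hphi) //; last by have := hQ i; rewrite /Q muln0.
  by rewrite /Q mulnS iterD.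
have per i : same_point (iter (n + i) mor P) (iter i mor P).
  rewrite addnC iterD; apply: (iter_same_point ured hphi); last by exists un.
  exact: iter_proj_point.
have hJ c f' : orbit_union_form phi P n c f' ->
    f' \is c.-homog /\ forall i, f'.@[Q i] = 0.
  move=> [hf' f0]; split=> // i; rewrite /Q.
  (* The forms vanish at the first [n] points; periodicity brings any later index back below [n]. *)
  elim/ltn_ind: (m * i)%N => t IH; have [/f0 //|le] := ltnP t n.
  have hs : same_point (iter (t - n) mor P) (iter t mor P).
    have [u uu eu] := per (t - n)%N; rewrite subnKC // in eu.
    by exists u^-1; rewrite ?unitrV // => j; rewrite eu mulKr.
  by apply: same_point_meval0 hf' hs _; apply: IH; lia.
have hnear : near_id pi (orbit_fun red Q) rV 1 1.
  apply: (near_id_orbit_fun hdvr pi0 vpi hred hQ hD QG hJ).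
  by rewrite /Q muln0 -(iter_rep_map ured hphi m hP).
have hring := orbit_fun_ring hdvr pi0 vpi hred hQ hD QG.
have nm : n = (m * (p ^ f.+1 * rV))%N by rewrite hnmr mulnAC -mulnA.
have lt : (0 < m * (p ^ f * rV) < n)%N.
  have := prime_gt1 pp; rewrite nm expnS; move: n0; rewrite nm expnS.
  by nia.
have [[j0 uj0] _] := hP.
have uj i : Q i j0 \is a GRing.unit.
  have := meval_orbit_unit hdvr pi0 vpi hred hQ i (dhomog_X R j0).
  by rewrite !mevalXU; apply; rewrite /Q muln0.
(* Affine coordinates in a chart containing every Q_i. *)
pose x j i := Q i j / Q i j0.
have Ox j : orbit_fun red Q (x j).
  eexists; apply: ratio_ext _ (ratio_quot hdvr pi0 vpi hred hQ
    (dhomog_X R j) (dhomog_X R j0) _) => [i|].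
    by rewrite !mevalXU.
  by rewrite mevalXU.
(* If all affine coordinates agreed, P would return after m p^f rV < n steps, against
   primitivity. *)
have [j xj] : exists j, x j (p ^ f * rV)%N != x j 0%N.
  apply/existsP; apply: contraT => /existsPn same.
  case: (nmin _ lt); exists (P j0 / Q (p ^ f * rV)%N j0).
    by rewrite unitrM unitrV uj0 uj.
  move=> j; have /negPn/eqP := same j; rewrite /x {3 4}/Q muln0 /= => exj.
  by rewrite mulrAC -mulrA exj mulrC divrK.
apply: (orbit_length_bound hdvr pi0 vpi hring pp hp hnear (Ox j) xj).
move=> y [u [c [a [b [ha hb ub _ ey]]]]].
(* This index is n steps of phi, so Q_0 returns up to a unit, which cancels in quotients of forms of
   equal degree. *)
have [w uw ew] : same_point (Q 0%N) (Q (p ^ f.+1 * rV)%N).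
  rewrite /Q muln0 -nm; exists un^-1; rewrite ?unitrV // => i.
  by rewrite /= (enP i) mulKr.
have := ey (p ^ f.+1 * rV)%N.
rewrite (dhomog_mevalZ ha ew) (dhomog_mevalZ hb ew) -ey mulrCA.
by move=> /(mulrI (unitrX c uw)) /(mulIr ub).
Qed.
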